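(* There exists a $\psi$-irreducible, aperiodic discrete-time Markov chain $\{X(n) : n\ge 0\}$, on some measurable space $(\mathsf{X},\mathcal{B})$ with countably generated $\sigma$-algebra $\mathcal{B}$, which is geometrically ergodic but does not admit a spectral gap in $L_2=L_2(\pi)$, where $\pi$ is its invariant probability measure.
   Context: Kernels: $P^n(x,A)=\Pr\{X(n)\in A\mid X(0)=x\}$, $P=P^1$, and $PF(x)=\int_{\mathsf{X}}P(x,dy)F(y)$ whenever the integral exists. $\psi$-irreducible and aperiodic: there is a nonzero $\sigma$-finite measure $\psi$ on $(\mathsf{X},\mathcal{B})$ such that for every $A\in\mathcal{B}$ with $\psi(A)>0$ and every $x\in\mathsf{X}$, $P^n(x,A)>0$ for all $n$ sufficiently large; moreover $\psi$ is maximal, in the sense that any other such $\psi'$ is absolutely continuous with respect to $\psi$. Geometrically ergodic: there exist an invariant measure $\pi$ on $(\mathsf{X},\mathcal{B})$ and functions $\rho:\mathsf{X}\to(0,1)$, $C:\mathsf{X}\to[1,\infty)$ such that $\|P^n(x,\cdot)-\pi\|_{\rm TV}\le C(x)\rho(x)^n$ for all $n\ge0$ and $\pi$-a.e. $x\in\mathsf{X}$, where $\|\mu\|_{\rm TV}=\sup_{A\in\mathcal{B}}|\mu(A)|$. Spectral gap in $L_2$: $L_2=L_2(\pi)$ is the Hilbert space of measurable $F:\mathsf{X}\to\mathbb{C}$ that are square-integrable under $\pi$, with norm $\|F\|_2=[\int|F|^2d\pi]^{1/2}$, and $P$ is viewed as a linear operator on $L_2$. Its spectrum $\mathcal{S}_2$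 is the set of nonzero $\lambda\in\mathbb{C}$ for which the inverse $(I\lambda-P)^{-1}$ does not exist as a bounded linear operator on $L_2$. A pole of finite multiplicity $m$ is an isolated point $\lambda_0$ of the spectrum whose associated spectral projection $\frac{1}{2\pi i}\oint(Iz-P)^{-1}dz$ (over a small circle around $\lambda_0$ enclosing no other point of the spectrum) has finite rank $m$. The chain (equivalently, $P$) admits a spectral gap in $L_2$ if there exists $\varepsilon_0>0$ such that $\mathcal{S}_2\cap\{z:|z|\ge1-\varepsilon_0\}$ is finite and contains only poles of finite multiplicity. *)

(* Defs.v *)
From HB Require Import structures.
From mathcomp Require Import all_boot all_order all_algebra complex.
From mathcomp Require Import all_classical all_reals all_analysis.

Set Implicit Arguments.
Unset Strict Implicit.
Unset Printing Implicit Defensive.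
Import Order.TTheory GRing.Theory Num.Theory.
Import numFieldNormedType.Exports.

Local Open Scope classical_set_scope.
Local Open Scope complex_scope.
Local Open Scope ring_scope.

Definition countably_generated d (X : measurableType d) : Prop :=
  exists G : set (set X), countable G /\ @measurable d X = <<s G >>.

Section chain.
Context d (X : measurableType d) (R : realType).
Variable P : R.-pker X ~> X.
Local Open Scope ereal_scope.

(* The chain is given by its transition kernel [P], and [step n x A] is
   P^n(x,A), the probability that X(n) is in A when X(0) = x. *)
Fixpoint step (n : nat) (x : X) (A : set X) : \bar R :=
  if n is m.+1 then \int[P x]_y step m y A else \d_x A.

Definition reaches (psi : {sigma_finite_measure set X -> \bar R}) : Prop :=
  psi [set: X] != 0 /\
  forall A, measurable A -> 0 < psi A ->
    forall x, \forall n \near \oo, 0 < step n x A.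

Definition psi_irreducible_aperiodic : Prop :=
  exists psi : {sigma_finite_measure set X -> \bar R},
    reaches psi /\
    forall psi' : {sigma_finite_measure set X -> \bar R},
      reaches psi' -> psi' `<< psi.

Definition TV_dist (mu nu : set X -> \bar R) : \bar R :=
  ereal_sup [set `|mu A - nu A| | A in measurable].

Variable mu : probability X R.

Definition invariant_measure : Prop :=
  forall A, measurable A -> \int[mu]_x P x A = mu A.

Definition geometrically_ergodic : Prop :=
  invariant_measure /\
  exists (rho C : X -> R),
    (forall x, (0 < rho x < 1)%R) /\ (forall x, (1 <= C x)%R) /\
    \forall x \ae mu, forall n,
       TV_dist (step n x) mu <= (C x * rho x ^+ n)%:E.

End chain.

(* L_2(mu) is handled through representatives: its elements are the functions
   F with [L2 mu F], and identities between them are meant mu-a.e. *)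
Section L2.
Context d (X : measurableType d) (R : realType).
Variable mu : probability X R.

Definition L2norm (F : X -> R[i]) : \bar R :=
  'N[mu]_2%:E [EFin \o (fun x => Normc.normc (F x))]%E.

Definition L2 (F : X -> R[i]) : Prop :=
  [/\ measurable_fun [set: X] (fun x => complex.Re (F x)),
      measurable_fun [set: X] (fun x => complex.Im (F x)) &
      (L2norm F < +oo)%E].

Definition operator := (X -> R[i]) -> X -> R[i].

Definition bounded_operator (T : operator) : Prop :=
  [/\ forall F, L2 F -> L2 (T F),
      forall F G, L2 F -> L2 G -> F = G %[ae mu] -> T F = T G %[ae mu],
      forall (a : R[i]) F G, L2 F -> L2 G ->
        T (fun x => a * F x + G x) = (fun x => a * T F x + T G x) %[ae mu] &
      exists K : R, forall F, L2 F -> (L2norm (T F) <= K%:E * L2norm F)%E].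

Definition has_rank (T : operator) (m : nat) : Prop :=
  exists b : 'I_m -> X -> R[i],
    [/\ forall i, exists2 F, L2 F & b i = T F %[ae mu],
        forall c : 'I_m -> R[i],
          (fun x => \sum_i c i * b i x) = cst 0 %[ae mu] -> forall i, c i = 0 &
        forall F, L2 F -> exists c : 'I_m -> R[i],
          T F = (fun x => \sum_i c i * b i x) %[ae mu]].

Definition circle_point (z0 : R[i]) (r t : R) : R[i] :=
  z0 + ((r * cos t) +i* (r * sin t)).

(* Riemann-Stieltjes sum of Q(z) dz over the circle |z - z0| = r, for the
   subdivision 0 :: s of [0, 2 pi] with tags c. *)
Definition circle_sum (Q : R[i] -> operator) (z0 : R[i]) (r : R)
    (s : seq R) (c : nat -> R) : operator :=
  fun F x => \sum_(k < size s)
    (circle_point z0 r (nth 0 s k) - circle_point z0 r (nth 0 (0 :: s) k)) *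
    Q (circle_point z0 r (c k)) F x.

(* J is the integral of Q(z) dz over the circle |z - z0| = r, counterclockwise:
   the limit, in operator norm, of the sums above as the mesh tends to 0. *)
Definition circle_integral (Q : R[i] -> operator) (z0 : R[i]) (r : R)
    (J : operator) : Prop :=
  bounded_operator J /\
  forall e : R, 0 < e -> exists2 delta : R, 0 < delta &
    forall (s : seq R) (c : nat -> R),
      itv_partition 0 (pi *+ 2) s ->
      (forall k, (k < size s)%N ->
        nth 0 (0 :: s) k <= c k <= nth 0 s k /\
        nth 0 s k - nth 0 (0 :: s) k < delta) ->
      forall F, L2 F ->
        (L2norm (fun x => (circle_sum Q z0 r s c F x - J F x)%R)
          <= e%:E * L2norm F)%E.

Variable P : R.-pker X ~> X.

(* For F in L_2(mu) and mu invariant, F is P x-integrable for mu-a.e. x; at the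
   other points the value below is the conventional one of [Rintegral]. *)
Definition kernel_operator : operator := fun F x =>
  (\int[P x]_y complex.Re (F y)) +i* (\int[P x]_y complex.Im (F y)).

Definition is_resolvent (z : R[i]) (T : operator) : Prop :=
  bounded_operator T /\
  forall F, L2 F ->
    T (fun x => z * F x - kernel_operator F x) = F %[ae mu] /\
    (fun x => z * T F x - kernel_operator (T F) x) = F %[ae mu].

Definition spectrum : set (R[i]) :=
  [set z | z != 0 /\ ~ exists T, is_resolvent z T].

Definition spectral_projection (z0 : R[i]) (r : R) (Pr : operator) : Prop :=
  exists Q : R[i] -> operator,
    (forall z, Normc.normc (z - z0) = r -> is_resolvent z (Q z)) /\
    exists2 J, circle_integral Q z0 r J &
      bounded_operator Pr /\
      forall F, L2 F ->
        Pr F = (fun x => (0 +i* (pi *+ 2))^-1 * J F x) %[ae mu].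

(* As 0 is never counted in [spectrum], the disc is also required to avoid 0,
   so that z0 is the only point of the usual spectrum inside the circle. *)
Definition pole_of_multiplicity (z0 : R[i]) (m : nat) : Prop :=
  spectrum z0 /\
  exists r : R,
    [/\ 0 < r < Normc.normc z0,
        forall z, Normc.normc (z - z0) <= r -> spectrum z -> z = z0 &
        exists2 Pr, spectral_projection z0 r Pr & has_rank Pr m].

Definition spectral_gap : Prop :=
  exists2 e0 : R, 0 < e0 &
    let S := spectrum `&` [set z | 1 - e0 <= Normc.normc z] in
    finite_set S /\
    forall z, S z -> exists m, pole_of_multiplicity z m.

End L2.

(* Main.v *)
(* The chain lives on pairs (a, r) = (age, residual time) of a renewal process
   with geometric(1/2) lifetimes: (a, r+1) moves to (a+1, r), and (a, 0) to
   (0, n) with probability 2^-(n+1).  The stationary law is the product of two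
   geometric laws.  If g(a) is the average of f(a, .) under the geometric law,
   one step of the chain turns g into (g(0) + g(.+1)) / 2, so the oscillation of
   g is halved at each step, whence P^n(x, A) -> pi(A) at rate 2^-n.  On the
   other hand the chain is deterministic along the tower {a + r = n}, so for
   |z| = 1 the function equal to z^a there and to 0 elsewhere is, for z, an
   eigenfunction up to an error carried by {r = 0}, of relative squared L2 norm
   O(1/n).  Hence the whole unit circle lies in the spectrum. *)
Require Import Defs.
From HB Require Import structures.
From mathcomp Require Import all_boot all_order all_algebra complex ring lra.
From mathcomp Require Import all_classical all_reals all_analysis.

Set Implicit Arguments.
Unset Strict Implicit.
Unset Printing Implicit Defensive.
Import Order.TTheory GRing.Theory Num.Theory.
Import numFieldNormedType.Exports.

Local Open Scope classical_set_scope.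
Local Open Scope ring_scope.

(** * The discrete sigma-algebra on pairs of naturals *)

(** A set of pairs is a union of singletons, taken as two nested countable unions over the
    coordinates, with [set0] standing for the missing points. *)
Lemma natxnat_sigma_algebra (S : set (set (nat * nat))) :
  sigma_algebra [set: nat * nat] S -> (forall x, S [set x]) ->
  S = [set: set (nat * nat)].
Proof.
move=> [S0 _ SU] S1; apply/seteqP; split=> // A _.
rewrite -[A](_ : \bigcup_n [set x | A x /\ x.1 = n] = A).
  apply: (SU) => n; rewrite (_ : [set x | _] =
    \bigcup_k (if (n, k) \in A then [set (n, k)] else set0)).
    by apply: SU => k; case: ifP.
  apply/seteqP; split=> [[a r]/= [Aar <-]|[a r]/= [k _]].
    by exists r => //; rewrite mem_set.
  by case: ifPn => //= + [-> ->]; rewrite inE.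
by apply/seteqP; split=> [x [n _ []]//|x Ax]; exists x.1.
Qed.

Lemma measurable_natxnat (A : set (nat * nat)) : measurable A.
Proof.
have := @natxnat_sigma_algebra measurable; move=> -> //.
  exact: sigma_algebra_measurable.
move=> [a r]; rewrite (_ : [set _] = [set a] `*` [set r]).
  exact: measurableX.
by apply/seteqP; split=> [_ ->|[? ?] [/= -> ->]].
Qed.

Lemma countably_generated_natxnat : countably_generated (nat * nat)%type.
Proof.
exists (range set1); split.
  exact: (sub_countable (card_image_le _ _)) (countableP _).
transitivity [set: set (nat * nat)].
  by apply/seteqP; split=> // A _; exact: measurable_natxnat.
apply/esym/natxnat_sigma_algebra; first exact: smallest_sigma_algebra.
by move=> x; apply: sub_sigma_algebra; exists x.
Qed.

Lemma measurable_fun_natxnat d (T : sigmaRingType d) (D : set (nat * nat))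
  (f : nat * nat -> T) : measurable_fun D f.
Proof. by move=> ? ? ?; exact: measurable_natxnat. Qed.

Lemma measurable_fun_nat d (T : sigmaRingType d) (D : set nat)
  (f : nat -> T) : measurable_fun D f.
Proof. by []. Qed.

(** * The geometric law with parameter 1/2 *)

Section geometric_law.
Variable R : realType.
Local Open Scope ereal_scope.

Definition geom : set nat -> \bar R :=
  mseries (fun n => mscale ((2^-1 ^+ n.+1)%:nng : {nonneg R})%R \d_n) 0.

HB.instance Definition _ := Measure.on geom.

Lemma geom_integral (f : nat -> \bar R) : (forall n, 0 <= f n) ->
  \int[geom]_n f n = \sum_(n <oo) (2^-1 ^+ n.+1)%:E * f n.
Proof.
move=> f0; rewrite ge0_integral_measure_series//.
apply: eq_eseriesr => n _.
rewrite ge0_integral_mscale// integral_dirac//.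
by rewrite diracT mul1e.
Qed.

(** Memorylessness: the law is the even mixture of the Dirac mass at 0 and of its own shift by one.
    Both the invariance of [stationary] and the contraction of means rest on it. *)
Lemma geom_integral_recl (f : nat -> \bar R) : (forall n, 0 <= f n) ->
  \int[geom]_n f n = 2^-1%:E * (f 0%N + \int[geom]_n f n.+1).
Proof.
move=> f0; have qf0 n m : 0 <= (2^-1 ^+ n)%:E * f m.
  by rewrite mule_ge0// lee_fin exprn_ge0// invr_ge0.
rewrite !geom_integral// nneseries_recl//.
rewrite ge0_muleDr//; last first.
  apply: nneseries_ge0 => n _ _; exact: qf0.
congr (_ + _).
rewrite -nneseriesZl//.
rewrite -(@nneseries_addn _ (fun n => (2^-1 ^+ n.+1)%:E * f n) 1)//=.
by apply: eq_eseriesr => n _; rewrite addn1 [in LHS]exprS EFinM muleA.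
Qed.

Lemma geom_recl (A : set nat) :
  geom A = 2^-1%:E * (\d_0%N A + geom (S @^-1` A)).
Proof.
have E (B : set nat) : geom B = \int[geom]_n (\1_B n)%:E.
  by rewrite integral_indic// setIT.
by rewrite !E geom_integral_recl.
Qed.

Lemma geom_setT : geom [set: nat] = 1.
Proof.
rewrite -[LHS]mul1e -(integral_cst geom measurableT) geom_integral//.
have /cvg_lim := @cvg_geometric_eseries_half R 1%R 0.
rewrite expr0 divr1 => lim1; rewrite -[RHS]lim1//.
apply: eq_eseriesr => n _ /=.
by rewrite mule1 addn1 natrX div1r exprVn.
Qed.

HB.instance Definition _ := Measure_isProbability.Build _ _ _ geom geom_setT.

Lemma geom1 n : geom [set n] = (2^-1 ^+ n.+1)%:E.
Proof.
elim: n => [|n IH]; rewrite geom_recl.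
  rewrite diracE mem_set// (_ : _ @^-1` _ = set0) ?measure0 ?adde0 ?mule1//.
  by apply/seteqP; split.
rewrite diracE memNset// add0e (_ : _ @^-1` _ = [set n]) ?IH -?EFinM -?exprS//.
by apply/seteqP; split => [k [->]|_ ->].
Qed.

End geometric_law.

(** * The chain and its stationary law *)

(** A fresh geometric sample [n] is supplied at every step and read only at residual time 0, so that
    every transition law is an image of the single measure [geom]. *)
Definition next_state (x : nat * nat) (n : nat) : nat * nat :=
  if x.2 is r.+1 then (x.1.+1, r) else (0%N, n).

HB.instance Definition _ x :=
  isMeasurableFun.Build _ _ _ _ (next_state x)
    (@measurable_fun_nat _ _ setT (next_state x)).

Section chain.
Variable R : realType.
Local Open Scope ereal_scope.

Definition chain_law (x : nat * nat) : pprobability (nat * nat)%type R :=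
  distribution (geom R) (next_state x).

Definition chain : R.-pker (nat * nat)%type ~> (nat * nat)%type :=
  kprobability (@measurable_fun_natxnat _ _ setT chain_law).

Definition stationary : probability (nat * nat)%type R := geom R \x geom R.

Lemma geom_cst (c : \bar R) : \int[geom R]_n c = c.
Proof. by rewrite integral_cst// [X in _ * X]geom_setT mule1. Qed.

Lemma integral_chain0 a (f : nat * nat -> \bar R) : (forall x, 0 <= f x) ->
  \int[chain (a, 0%N)]_y f y = \int[geom R]_n f (0%N, n).
Proof.
move=> f0; rewrite ge0_integral_distribution//.
exact: measurable_fun_natxnat.
Qed.

Lemma integral_chainS a r (f : nat * nat -> \bar R) : (forall x, 0 <= f x) ->
  \int[chain (a, r.+1)]_y f y = f (a.+1, r).
Proof.
move=> f0; rewrite ge0_integral_distribution//; last first.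
  exact: measurable_fun_natxnat.
exact: (geom_cst (f (a.+1, r))).
Qed.

Let mean (f : nat * nat -> \bar R) a := \int[geom R]_r f (a, r).

Let mean_ge0 f a : (forall x, 0 <= f x) -> 0 <= mean f a.
Proof. by move=> f0; exact: integral_ge0. Qed.

(** With probability 1/2 the residual time is 0 and the chain renews at age 0; otherwise the age
    grows by one and, by memorylessness, the new residual time is again geometric. *)
Lemma mean_chain f a : (forall x, 0 <= f x) ->
  mean (fun x => \int[chain x]_y f y) a =
  2^-1%:E * (mean f 0%N + mean f a.+1).
Proof.
move=> f0; rewrite /mean geom_integral_recl; last first.
  by move=> n; exact: integral_ge0.
rewrite integral_chain0//; congr (_ * (_ + _)).
by apply: eq_integral => r _; rewrite integral_chainS.
Qed.

Lemma integral_stationary f : (forall x, 0 <= f x) ->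
  \int[stationary]_x f x = \int[geom R]_a mean f a.
Proof.
by move=> f0; apply: fubini_tonelli1 => //; exact: measurable_fun_natxnat.
Qed.

(** Averaging [mean_chain] over a geometric age gives the right-hand side of [geom_integral_recl]
    for [mean f]. *)
Lemma stationary_chain f : (forall x, 0 <= f x) ->
  \int[stationary]_x \int[chain x]_y f y = \int[stationary]_x f x.
Proof.
move=> f0; rewrite !integral_stationary//; last first.
  by move=> x; exact: integral_ge0.
under eq_integral => a _ do rewrite mean_chain//.
rewrite ge0_integralZl//; last by move=> a _; rewrite adde_ge0// mean_ge0.
rewrite ge0_integralD//; [|by move=> a _; exact: mean_ge0..].
rewrite geom_cst.
by rewrite [RHS]geom_integral_recl// => n; exact: mean_ge0.
Qed.

(** * Convergence of the steps and geometric ergodicity *)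

Lemma step_ge0 n x A : 0 <= step chain n x A.
Proof.
elim: n x => [|n IH] x /=; last by apply: integral_ge0 => y _; exact: IH.
by rewrite diracE lee_fin.
Qed.
#[local] Hint Resolve step_ge0 : core.

Lemma step_le1 n x A : step chain n x A <= 1.
Proof.
elim: n x => [|n IH] x /=; first by rewrite diracE lee_fin; case: (_ \in _).
apply: (@le_trans _ _ (\int[chain x]_y 1)).
  by apply: ge0_le_integral => //; exact: measurable_fun_natxnat.
by rewrite integral_cst// mul1e prob_kernel.
Qed.

Lemma stationary_step n A : \int[stationary]_x step chain n x A = stationary A.
Proof.
elim: n => [|n IH] /=; last by rewrite stationary_chain.
rewrite [LHS](_ : _ = \int[stationary]_x (\1_A x)%:E)//.
by rewrite integral_indic ?setIT//; exact: measurable_natxnat.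
Qed.

Let mean_stepS n A a : mean (step chain n.+1 ^~ A) a =
  2^-1%:E * (mean (step chain n ^~ A) 0%N + mean (step chain n ^~ A) a.+1).
Proof. exact: mean_chain. Qed.

(** The term at age 0 is common to both means, so only half of the previous gap survives. The
    additive form avoids subtraction in the extended reals. *)
Lemma osc_mean_step n A a b :
  mean (step chain n ^~ A) a <= mean (step chain n ^~ A) b + (2^-1 ^+ n)%:E.
Proof.
elim: n a b => [|n IH] a b.
  rewrite expr0; apply: (@le_trans _ _ 1); last first.
    by rewrite leeDr// mean_ge0.
  rewrite -[leRHS]geom_cst; apply: ge0_le_integral => // r _.
  exact: step_le1.
have q0 : 0 <= (2^-1 ^+ n)%:E :> \bar R by rewrite lee_fin exprn_ge0// invr_ge0.
have mean0 c : 0 <= mean (step chain n ^~ A) c by exact: mean_ge0.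
rewrite !mean_stepS exprS EFinM.
move: (mean0 0%N) (mean0 b.+1) (IH a.+1 b.+1).
move: (mean _ 0%N) (mean _ a.+1) (mean _ b.+1) => m0 ma mb m0_ge0 mb_ge0 mab.
rewrite -ge0_muleDr ?adde_ge0// lee_pmul2l ?lte_fin ?invr_gt0// -addeA.
exact: leeD2l.
Qed.

(** By invariance [stationary A] is the geometric average of the means over all ages, so the
    oscillation bound is integrated in one of its two ages. *)
Lemma mean_step_stationary n A a :
  mean (step chain n ^~ A) a <= stationary A + (2^-1 ^+ n)%:E /\
  stationary A <= mean (step chain n ^~ A) a + (2^-1 ^+ n)%:E.
Proof.
have q0 : 0 <= (2^-1 ^+ n)%:E :> \bar R by rewrite lee_fin exprn_ge0// invr_ge0.
rewrite -(stationary_step n) integral_stationary//; split.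
  rewrite -[leLHS]geom_cst -[X in _ <= _ + X]geom_cst -ge0_integralD//.
    apply: ge0_le_integral => // *; last exact: osc_mean_step.
    exact: mean_ge0.
  by move=> *; exact: mean_ge0.
rewrite -[leRHS]geom_cst; apply: ge0_le_integral => // *.
  exact: mean_ge0.
exact: osc_mean_step.
Qed.

(** The chain runs deterministically until the residual time is used up, then renews and averages
    over the geometric law; each step spent on the way costs a factor 2 in the constant. *)
Lemma step_stationary n A a r : measurable A ->
  step chain n (a, r) A <= stationary A + (2 ^+ r.+1 * 2^-1 ^+ n)%:E /\
  stationary A <= step chain n (a, r) A + (2 ^+ r.+1 * 2^-1 ^+ n)%:E.
Proof.
move=> mA; elim: n a r => [|n IH] a r.
  have c1 : 1 <= (2 ^+ r.+1 * 2^-1 ^+ 0)%:E :> \bar R.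
    by rewrite expr0 mulr1 lee_fin exprn_ege1// ler1n.
  split; apply: le_trans (leeD _ c1) => //.
  - by rewrite (le_trans (@step_le1 0 _ _))// leeDr.
  - by rewrite (le_trans (probability_le1 _ mA))// leeDr.
have halve k : (2 ^+ k.+1 * 2^-1 ^+ n.+1 = 2 ^+ k * 2^-1 ^+ n :> R)%R.
  by rewrite [in LHS]exprS [(2^-1 ^+ n.+1)%R]exprS; field.
(* For [r.+1] the induction hypothesis at [(a.+1, r)] applies; for 0 the step yields the mean at age
   0, with error exactly [2^-1 ^+ n]. *)
rewrite halve; case: r => [|r] /=; last by rewrite integral_chainS.
by rewrite integral_chain0// expr0 mul1r; exact: mean_step_stationary.
Qed.

Lemma geometrically_ergodic_chain : geometrically_ergodic chain stationary.
Proof.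
split=> [A mA|].
  rewrite -[RHS](stationary_step 1); apply: eq_integral => x _ /=.
  rewrite [RHS](_ : _ = \int[chain x]_y (\1_A y)%:E)//.
  by rewrite integral_indic// setIT.
exists (fun=> 2^-1)%R, (fun x => 2 ^+ x.2.+1)%R; split=> [_|].
  by rewrite invr_gt0 ltr0n invf_lt1// ltr1n.
split=> [x|]; first by rewrite exprn_ege1// ler1n.
apply: aeW => -[a r] n; apply: ge_ereal_sup => _ [A mA <-].
have [] := step_stationary n a r mA.
(* Finiteness of both masses turns the two one-sided bounds into a bound on a real absolute
   value. *)
have : step chain n (a, r) A \is a fin_num.
  by rewrite ge0_fin_numE// (le_lt_trans (@step_le1 _ _ _))// ltry.
have : stationary A \is a fin_num by exact: fin_num_measure.
move: (step _ _ _ _) (stationary A) => [s| |] [p| |]// _ _.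
by rewrite -EFinB abse_EFin -!EFinD !lee_fin ler_norml; lra.
Qed.

End chain.

(** * Null sets, irreducibility and aperiodicity *)

Section null_sets.
Variable R : realType.
Local Open Scope ereal_scope.

Lemma stationary1 x : stationary R [set x] = (2^-1 ^+ (x.1 + x.2).+2)%:E.
Proof.
case: x => a r; rewrite (_ : [set _] = [set a] `*` [set r]); last first.
  by apply/seteqP; split=> [_ ->|[? ?] [/= -> ->]].
transitivity (geom R [set a] * geom R [set r]); first exact: product_measure1E.
by rewrite !geom1 -EFinM -exprD addSn addnS.
Qed.

Lemma stationary_eq0 A : stationary R A = 0 -> A = set0.
Proof.
move=> A0; apply/seteqP; split=> // x Ax.
suff: stationary R [set x] <= stationary R A.
  by rewrite A0 stationary1 lee_fin leNgt exprn_gt0 ?invr_gt0.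
by rewrite le_measure ?inE//; [exact: measurable_natxnat..|move=> _ ->].
Qed.

(** Every point has positive mass, so the empty set is the only null set. *)
Lemma ae_stationary (Q : nat * nat -> Prop) :
  (\forall x \ae stationary R, Q x) -> forall x, Q x.
Proof.
move=> [N [_ /stationary_eq0 -> NQ]] x; apply: contrapT => Qx.
exact: NQ Qx.
Qed.

(** The stationary law serves as psi: the convergence bound makes the step probability positive once
    its error is below the mass of [A], and maximality holds because only the empty set is null. *)
Lemma psi_irreducible_aperiodic_chain : psi_irreducible_aperiodic (chain R).
Proof.
exists (stationary R); split.
  split; first by rewrite /= probability_setT oner_neq0.
  move=> A mA A0 [a r].
  have Afin : stationary R A \is a fin_num by exact: fin_num_measure.
  have {}A0 : (0 < fine (stationary R A))%R by rewrite -lte_fin fineK.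
  have : (GRing.exp (2^-1 : R) @ \oo --> 0)%R.
    by apply: cvg_expr; rewrite ger0_norm ?invr_ge0// invf_lt1// ltr1n.
  move=> /cvgrPdist_lt /(_ (fine (stationary R A) / 2 ^+ r.+1)%R).
  move=> /(_ _)/wrap[|]; first by rewrite divr_gt0// exprn_gt0.
  move=> H; near=> n; have [_] := step_stationary R n a r mA.
  apply: contraPlt => s0; apply/negP; rewrite -ltNge.
  have : (2 ^+ r.+1 * 2^-1 ^+ n < fine (stationary R A) :> R)%R.
    rewrite mulrC -ltr_pdivlMr ?exprn_gt0//.
    have : (`|0 - 2^-1 ^+ n| < fine (stationary R A) / 2 ^+ r.+1)%R by near: n.
    by rewrite sub0r normrN ger0_norm// exprn_ge0// invr_ge0.
  rewrite -lte_fin (fineK Afin); apply: le_lt_trans.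
  by rewrite -[leRHS]add0e leeD2r.
move=> psi' _; apply/null_content_dominatesP => A mA /stationary_eq0 ->.
exact: measure0.
Unshelve. all: by end_near.
Qed.

End null_sets.

(** * Approximate eigenfunctions and the unit circle *)

Section spectrum.
Variable R : realType.
Local Notation mu := (stationary R).
Local Notation P := (chain R).
Local Open Scope complex_scope.

Lemma integral_chainS_signed a r (f : nat * nat -> R) :
  \int[P (a, r.+1)]_y f y = f (a.+1, r).
Proof.
rewrite /Rintegral integral_distribution.
- by rewrite (geom_cst (f (a.+1, r))%:E).
- exact: measurable_fun_natxnat.
- exact: (finite_measure_integrable_cst _ (f (a.+1, r))).
Qed.

Lemma indic_set1 (n r : nat) : \1_[set n] r = (r == n)%:R :> R.
Proof.
rewrite indicE; congr ((nat_of_bool _)%:R).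
by apply/idP/eqP => [/set_mem|/mem_set].
Qed.

Lemma integral_chain0_indic a n (c : R) (f : nat * nat -> R) :
  (forall r, f (0, r)%N = c * (r == n)%:R) ->
  \int[P (a, 0%N)]_y f y = c * 2^-1 ^+ n.+1.
Proof.
move=> fE.
have E : EFin \o (f \o next_state (a, 0%N)) =
    (fun r => c%:E * (\1_[set n] r)%:E)%E.
  by apply/funext => r /=; rewrite /next_state/= fE EFinM indic_set1.
have I : (geom R).-integrable [set: nat] (EFin \o \1_[set n]).
  exact: integrable_indic.
rewrite /Rintegral integral_distribution.
- rewrite [X in integral _ _ X]E integralZl// integral_indic// setIT.
  by rewrite [X in (_ * X)%E]geom1.
- exact: measurable_fun_natxnat.
- by rewrite [X in integrable _ _ X]E; exact: integrableZl.
Qed.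

Definition tower (z : R[i]) (n : nat) (x : nat * nat) : R[i] :=
  if (x.1 + x.2 == n)%N then z ^+ x.1 else 0.

Lemma kernel_operatorS F a r : kernel_operator P F (a, r.+1) = F (a.+1, r).
Proof.
rewrite /kernel_operator !integral_chainS_signed.
by case: (F _).
Qed.

Lemma kernel_operator_tower0 z n a :
  kernel_operator P (tower z n) (a, 0%N) = (2^-1 ^+ n.+1)%:C.
Proof.
rewrite /kernel_operator (@integral_chain0_indic _ n 1); last first.
  by move=> r; rewrite /tower/= add0n; case: eqP; rewrite ?mulr1 ?mulr0.
rewrite (@integral_chain0_indic _ n 0) ?mul1r ?mul0r//.
by move=> r; rewrite /tower/= mul0r; case: ifP.
Qed.

Lemma normc_ge0 (z : R[i]) : 0 <= Normc.normc z.
Proof. by case: z => a b; exact: sqrtr_ge0. Qed.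

Lemma normcX (z : R[i]) n : Normc.normc (z ^+ n) = Normc.normc z ^+ n.
Proof.
elim: n => [|n IH]; first by rewrite !expr0 Normc.normc1.
by rewrite !exprS Normc.normcM IH.
Qed.

Lemma ler_normcB (x y : R[i]) :
  Normc.normc (x - y) <= Normc.normc x + Normc.normc y.
Proof. by rewrite -lecR rmorphD; exact: (ler_normB x y). Qed.

Lemma normc_real (c : R) : Normc.normc c%:C = `|c|.
Proof. by rewrite /= expr0n addr0 sqrtr_sqr. Qed.

(** The defect vanishes where the residual time is positive. At [(n, 0)] it is
    [z ^+ n.+1 - 2^-1 ^+ n.+1], of modulus at most 2; at the other points [(a, 0)] its modulus is
    [2^-1 ^+ n.+1]. *)
Lemma sqr_normc_tower_defect z n x : Normc.normc z = 1 ->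
  Normc.normc (z * tower z n x - kernel_operator P (tower z n) x) ^+ 2
    <= 4 * \1_[set (n, 0%N)] x + 2^-1 ^+ (n.+1).*2.
Proof.
move=> z1.
have q0 m : 0 <= 2^-1 ^+ m :> R by rewrite exprn_ge0 ?invr_ge0.
have q1 : 2^-1 ^+ n.+1 <= 1 :> R.
  by rewrite exprn_ile1 ?invr_ge0// invf_le1// ler1n.
case: x => a [|r]; last first.
  rewrite kernel_operatorS /tower /= addSnnS; case: ifP => _.
    by rewrite -exprS subrr Normc.normc0 expr0n addr_ge0// mulr_ge0.
  by rewrite mulr0 subrr Normc.normc0 expr0n addr_ge0// mulr_ge0.
rewrite kernel_operator_tower0 /tower/= addn0; case: eqP => [->|an].
  rewrite indicE mem_set// mulr1 -exprS.
  apply: (@le_trans _ _ 4); last by rewrite lerDl.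
  rewrite (_ : 4 = 2 ^+ 2 :> R); last by rewrite -natrX.
  rewrite ler_sqr ?nnegrE ?normc_ge0//.
  rewrite (le_trans (ler_normcB _ _))// normcX z1 expr1n normc_real ger0_norm//.
  by rewrite -[2]/(1 + 1) lerD2l.
rewrite mulr0 sub0r indicE memNset; last by case.
rewrite mulr0 add0r -muln2 exprM ler_sqr ?nnegrE ?normc_ge0//.
rewrite (_ : - _ = (- 2^-1 ^+ n.+1)%:C); last by rewrite rmorphN.
by rewrite normc_real normrN ger0_norm.
Qed.

(** The tower has [n.+1] points, each of mass [2^-1 ^+ n.+2], and the function has modulus 1
    there. *)
Lemma integral_sqr_tower z n : Normc.normc z = 1 ->
  (\int[mu]_x (Normc.normc (tower z n x) ^+ 2)%:E =
   (n.+1%:R * 2^-1 ^+ n.+2)%:E)%E.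
Proof.
move=> z1.
transitivity (\int[geom R]_a \int[geom R]_r ((a + r == n)%N%:R)%:E)%E.
  rewrite integral_stationary; last by move=> x; rewrite lee_fin sqr_ge0.
  apply: eq_integral => a _; apply: eq_integral => r _; congr EFin.
  rewrite /tower/=; case: eqP => _; last by rewrite Normc.normc0 expr0n.
  by rewrite normcX z1 !expr1n.
have inner m : (\int[geom R]_r ((r == m)%:R)%:E = (2^-1 ^+ m.+1)%:E)%E.
  rewrite (eq_integral (fun r => (\1_[set m] r)%:E)) => [|r _].
    by rewrite integral_indic// setIT [LHS]geom1.
  by rewrite indic_set1.
(* Once age 0 is split off, shifting the age turns tower [n.+1] into tower [n]. *)
elim: n => [|n IH]; rewrite geom_integral_recl => [|a]; try exact: integral_ge0.
  rewrite inner (eq_integral (fun=> 0%E)) => [|a _]; last first.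
    by rewrite integral0_eq.
  by rewrite integral0 adde0 -EFinM mul1r -exprS.
rewrite inner.
under eq_integral do under eq_integral do rewrite addSn eqSS.
rewrite IH -EFinD -EFinM; congr EFin.
by rewrite [in RHS]exprS -[n.+2%:R]natr1 mulrDl mul1r; ring.
Qed.

Lemma L2norm_sqrt (F : nat * nat -> R[i]) (s : R) : 0 <= s ->
  (\int[mu]_x (Normc.normc (F x) ^+ 2)%:E = s%:E)%E ->
  L2norm mu F = (Num.sqrt s)%:E.
Proof.
move=> s0 Fs; rewrite /L2norm unlock.
rewrite (eq_integral (fun x => (Normc.normc (F x) ^+ 2)%:E)) => [|x _].
  by rewrite Fs poweR_EFin powR12_sqrt.
rewrite abse_EFin poweR_EFin -[2]/(2%:R) powR_mulrn//.
by rewrite ger0_norm ?normc_ge0.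
Qed.

Lemma L2norm_le_sqrt (F : nat * nat -> R[i]) (s : R) :
  (\int[mu]_x (Normc.normc (F x) ^+ 2)%:E <= s%:E)%E ->
  (L2norm mu F <= (Num.sqrt s)%:E)%E.
Proof.
have I0 : (0 <= \int[mu]_x (Normc.normc (F x) ^+ 2)%:E)%E.
  by apply: integral_ge0 => x _; rewrite lee_fin sqr_ge0.
case E : (\int[mu]_x (Normc.normc (F x) ^+ 2)%:E)%E => [t| |]//; last first.
  by rewrite E in I0.
move: I0; rewrite E !lee_fin => t0 ts.
by rewrite (L2norm_sqrt t0 E) lee_fin ler_wsqrtr.
Qed.

Lemma L2_natxnat (F : nat * nat -> R[i]) : (L2norm mu F < +oo)%E -> L2 mu F.
Proof. by move=> F2; split=> //; exact: measurable_fun_natxnat. Qed.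

(** A resolvent of bound [K] would recover the tower function from its defect and force
    [n.+1 <= 5 * K ^+ 2] for every [n]. *)
Lemma unit_circle_spectrum z : Normc.normc z = 1 -> spectrum mu P z.
Proof.
move=> z1; split.
  apply/eqP => z0; move/eqP: z1.
  by rewrite z0 Normc.normc0 eq_sym oner_eq0.
move=> [T [[_ _ _ [K TK]] TP]].
have q0 m : 0 <= 2^-1 ^+ m :> R by rewrite exprn_ge0 ?invr_ge0.
(* The Archimedean bound makes [n] exceed [5 * K ^+ 2]. *)
pose n := Num.bound (5 * K ^+ 2).
pose F := tower z n.
pose G x := z * F x - kernel_operator P F x.
have FE : L2norm mu F = (Num.sqrt (n.+1%:R * 2^-1 ^+ n.+2))%:E.
  by apply: L2norm_sqrt; [rewrite mulr_ge0|exact: integral_sqr_tower].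
have GE : (L2norm mu G <= (Num.sqrt (5 * 2^-1 ^+ n.+2))%:E)%E.
  apply: L2norm_le_sqrt.
  apply: (@le_trans _ _ (\int[mu]_x (4%:E * (\1_[set (n, 0%N)] x)%:E
                                    + (2^-1 ^+ (n.+1).*2)%:E))%E).
    apply: ge0_le_integral => //; try exact: measurable_fun_natxnat.
    - by move=> x _; rewrite lee_fin sqr_ge0.
    - by move=> x _; rewrite -EFinM -EFinD lee_fin sqr_normc_tower_defect.
  rewrite ge0_integralD//; try exact: measurable_fun_natxnat.
  rewrite ge0_integralZl//; try exact: measurable_fun_natxnat.
  rewrite integral_indic//; last exact: measurable_natxnat.
  rewrite setIT [X in (_ * X + _)%E]stationary1.
  rewrite integral_cst// [X in (_ + _ * X)%E]probability_setT mule1.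
  rewrite -EFinM -EFinD lee_fin /= addn0.
  (* The small defect on [{r = 0}] is absorbed, which turns the constant 4 into 5. *)
  have : 2^-1 ^+ (n.+1).*2 <= 2^-1 ^+ n.+2 :> R.
    rewrite ler_wiXn2l ?invr_ge0 ?invf_le1 ?ler1n//.
    by rewrite -addnn addSn addnS !ltnS leq_addr.
  by lra.
have L2F : L2 mu F by apply: L2_natxnat; rewrite FE ltry.
have L2G : L2 mu G by apply: L2_natxnat; rewrite (le_lt_trans GE)// ltry.
have TG : T G = F.
  by apply/funext => x; have [/ae_stationary TF _] := TP F L2F; exact: TF.
have := TK G L2G; rewrite TG FE => FK.
(* The sign of [K] is unknown, so [|K|] replaces it before squaring. *)
have : ((Num.sqrt (n.+1%:R * 2^-1 ^+ n.+2))%:E <=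
        (`|K| * Num.sqrt (5 * 2^-1 ^+ n.+2))%:E :> \bar R)%E.
  apply: (le_trans FK); apply: (@le_trans _ _ (`|K|%:E * L2norm mu G)%E).
    by apply: lee_wpmul2r; [exact: Lnorm_ge0|rewrite lee_fin ler_norm].
  by rewrite EFinM lee_wpmul2l.
rewrite lee_fin -(sqrtr_sqr K) -sqrtrM ?sqr_ge0// ler_sqrt; last first.
  by rewrite mulr_ge0 ?sqr_ge0// mulr_ge0.
rewrite [_ ^+ 2 * _]mulrA ler_pM2r ?exprn_gt0 ?invr_gt0//.
apply/negP; rewrite -ltNge mulrC.
apply: (@lt_le_trans _ _ n%:R); last by rewrite ler_nat.
by rewrite archi_boundP// mulr_ge0// sqr_ge0.
Qed.

(** The points of the circle with real part [1 / (k + 1)] and nonnegative imaginary part are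
    pairwise distinct. *)
Lemma infinite_unit_circle (S : set R[i]) :
  [set z | Normc.normc z = 1] `<=` S -> ~ finite_set S.
Proof.
move=> CS fS; apply: infinite_nat.
pose f k : R[i] := k.+1%:R^-1 +i* Num.sqrt (1 - k.+1%:R^-1 ^+ 2).
rewrite (_ : [set: nat] = f @^-1` S).
  apply: finite_preimage => // k l _ _ [/invr_inj/eqP + _].
  by rewrite eqr_nat => /eqP [].
apply/seteqP; split=> // k _; apply: CS => /=.
rewrite sqr_sqrtr ?subrKC ?sqrtr1// subr_ge0 expr_le1// ?invr_ge0//.
by rewrite invf_le1 ?ler1n.
Qed.

(** Finiteness already fails: every region [1 - e0 <= |z|] contains the unit circle. *)
Lemma no_spectral_gap_chain : ~ spectral_gap mu P.
Proof.
move=> [e0 e0_gt0 [fS _]]; apply: infinite_unit_circle fS => z z1; split.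
  exact: unit_circle_spectrum.
by rewrite /= z1 gerBl ltW.
Qed.

End spectrum.

Theorem theorem1p4 (R : realType) :
  exists (d : measure_display) (X : measurableType d) (P : R.-pker X ~> X)
         (pi : probability X R),
    countably_generated X /\
    psi_irreducible_aperiodic P /\
    geometrically_ergodic P pi /\
    ~ spectral_gap pi P.
Proof.
exists _, (nat * nat)%type, (chain R), (stationary R).
split; first exact: countably_generated_natxnat.
split; first exact: psi_irreducible_aperiodic_chain.
split; first exact: geometrically_ergodic_chain.
exact: no_spectral_gap_chain.
Qed.
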